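(* Let $g_1(\mathbf x),\dots,g_k(\mathbf x)$ be polynomial functions of the real variables $\mathbf x=(x_1,\dots,x_m)$, where each $x_j$ ranges over a given interval $I_j\subseteq\mathbb R$ (its range), and let $\epsilon>0$. Let $p$ be the output of the positive-negative (PN) decomposition procedure (described in the context) applied to $g_1,\dots,g_k$. Then for all $\mathbf x\in I_1\times\cdots\times I_m$ and all $\mathbf e=(e_1,\dots,e_k)\in\mathbb R^k$ with $|e_i|\le\epsilon$ for every $i$, $$\sum_{i=1}^k |g_i(\mathbf x)\,e_i|\;\le\; p(\mathbf x)\cdot\epsilon .$$
   Context: For a real number $y$ write $y^+=\max\{y,0\}$ and $y^-=\max\{-y,0\}$. A term is a product $c\,y_1^{a_1}\cdots y_r^{a_r}$ with nonzero real coefficient $c$, symbols (variables) $y_l$ and nonnegative integer exponents $a_l$; each $y_l^{a_l}$ is a factor of the term. An expression is in polynomial form if it is a finite sum of terms. PN decomposition procedure, on input polynomials $g_1,\dots,g_k$ in $x_1,\dots,x_m$ with ranges $I_1,\dots,I_m$: start with $p:=0$; for each $i=1,\dots,k$: (1) expand $g_i$ into polynomial form in $x_1,\dots,x_m$; (2) for every factor $x_j^a$ (in every term) with $a$ odd: if $I_j$ contains both a positive and a negative value, replace $x_j^a$ by $(x_j^+)^a-(x_j^-)^a$; if $I_j\subseteq(-\infty,0]$, replace $x_j^a$ by $-(x_j^-)^a$; otherwise leave it unchanged; (3) expand the result again into polynomial form in the symbols $x_j,x_j^+,x_j^-$ (possibly simplifying with the identity $x_j^+x_j^-=0$); (4)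 let $g_i^+$ be the sum of the terms with positive coefficient and $g_i^-$ be the negative of the sum of the terms with negative coefficient; (5) set $p:=p+g_i^++g_i^-$. The output $p$ is a polynomial in the symbols $x_j,x_j^+,x_j^-$, and $p(\mathbf x)$ denotes its value when each $x_j^+$ is set to $\max\{x_j,0\}$ and each $x_j^-$ to $\max\{-x_j,0\}$. *)

(* Defs.v *)
From HB Require Import structures.
From mathcomp Require Import all_boot all_order all_algebra.
From mathcomp Require Import mpoly.
From mathcomp Require Import boolp reals.

Set Implicit Arguments.
Unset Strict Implicit.
Unset Printing Implicit Defensive.

Import Order.TTheory GRing.Theory Num.Theory.

Local Open Scope ring_scope.

(* (c, a) stands for the term c * y_1 ^ a_1 * ... * y_n ^ a_n; the condition
   c != 0 is imposed in is_polyform. *)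
Definition pterm (R : realType) (n : nat) : Type := (R * 'X_{1..n})%type.

Definition pform_value (R : realType) (n : nat) (s : seq (pterm R n)) :
    {mpoly R[n]} :=
  \sum_(t <- s) t.1 *: 'X_[t.2].

(* Like terms need not be collected. *)
Definition is_polyform (R : realType) (n : nat) (g : {mpoly R[n]})
    (s : seq (pterm R n)) : Prop :=
  (forall t, t \in s -> t.1 != 0) /\ pform_value s = g.

(* The 3m symbols, indexed by 'I_(m + (m + m)): first the x_j, then the x_j^+,
   then the x_j^-. *)
Definition sym_var (m : nat) (j : 'I_m) : 'I_(m + (m + m)) := lshift (m + m) j.

Definition sym_pos (m : nat) (j : 'I_m) : 'I_(m + (m + m)) :=
  rshift m (lshift m j).

Definition sym_neg (m : nat) (j : 'I_m) : 'I_(m + (m + m)) :=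
  rshift m (rshift m j).

Definition sym_val (R : realType) (m : nat) (x : 'I_m -> R)
    (i : 'I_(m + (m + m))) : R :=
  match split i with
  | inl j => x j
  | inr i' =>
    match split i' with
    | inl j => Num.max (x j) 0
    | inr j => Num.max (- x j) 0
    end
  end.

Definition mixed_sign (R : realType) (J : interval R) : Prop :=
  (exists2 y, y \in J & 0 < y) /\ (exists2 y, y \in J & y < 0).

Definition nonpos_range (R : realType) (J : interval R) : Prop :=
  forall y, y \in J -> y <= 0.

(* The sum of terms that takes the place of the factor x_j ^ a when x_j has
   range J. *)
Definition replace_factor (R : realType) (m : nat) (J : interval R)
    (j : 'I_m) (a : nat) : seq (pterm R (m + (m + m))) :=
  if odd a then
    if `[< mixed_sign J >] then
      [:: (1, (U_(sym_pos j) *+ a)%MM); (-1, (U_(sym_neg j) *+ a)%MM)]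
    else if `[< nonpos_range J >] then [:: (-1, (U_(sym_neg j) *+ a)%MM)]
    else [:: (1, (U_(sym_var j) *+ a)%MM)]
  else [:: (1, (U_(sym_var j) *+ a)%MM)].

Definition pform_mul (R : realType) (n : nat) (s t : seq (pterm R n)) :
    seq (pterm R n) :=
  [seq (u.1 * v.1, (u.2 + v.2)%MM) | u <- s, v <- t].

(* The replacement applied to all factors of a term, with the resulting product
   of sums multiplied out. *)
Definition replace_term (R : realType) (m : nat) (I : 'I_m -> interval R)
    (t : pterm R m) : seq (pterm R (m + (m + m))) :=
  pform_mul [:: (t.1, 0%MM)]
    (\big[@pform_mul R (m + (m + m))/[:: (1, 0%MM)]]_(j < m)
        replace_factor (I j) j (t.2 j)).

Definition replace_pform (R : realType) (m : nat) (I : 'I_m -> interval R)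
    (s : seq (pterm R m)) : seq (pterm R (m + (m + m))) :=
  flatten [seq replace_term I t | t <- s].

(* The optional simplifications of a sum of terms: reordering, collecting like
   terms, and deleting terms by means of x_j^+ * x_j^- = 0. Any number of them,
   possibly none, may be carried out. *)
Inductive simplifies (R : realType) (m : nat) :
    seq (pterm R (m + (m + m))) -> seq (pterm R (m + (m + m))) -> Prop :=
| simp_done s : simplifies s s
| simp_perm s s' t : perm_eq s s' -> simplifies s' t -> simplifies s t
| simp_collect c d a s t : c + d != 0 ->
    simplifies ((c + d, a) :: s) t -> simplifies [:: (c, a), (d, a) & s] t
| simp_cancel c d a s t : c + d = 0 ->
    simplifies s t -> simplifies [:: (c, a), (d, a) & s] t
| simp_posneg c (a : 'X_{1..m + (m + m)}) j s t :
    (0 < a (sym_pos j))%N -> (0 < a (sym_neg j))%N ->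
    simplifies s t -> simplifies ((c, a) :: s) t.

Definition pos_part (R : realType) (n : nat) (s : seq (pterm R n)) :
    {mpoly R[n]} :=
  \sum_(t <- s | 0 < t.1) t.1 *: 'X_[t.2].

Definition neg_part (R : realType) (n : nat) (s : seq (pterm R n)) :
    {mpoly R[n]} :=
  - \sum_(t <- s | t.1 < 0) t.1 *: 'X_[t.2].

(* The procedure leaves open how far the sums of terms are simplified, so its
   output is described by a relation: p is the output of some run. Here s i is
   the polynomial form of g_i in the x_j, and t i the one in the 3m symbols. *)
Definition PN_output (R : realType) (m k : nat) (I : 'I_m -> interval R)
    (g : 'I_k -> {mpoly R[m]}) (p : {mpoly R[m + (m + m)]}) : Prop :=
  exists (s : 'I_k -> seq (pterm R m))
         (t : 'I_k -> seq (pterm R (m + (m + m)))),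
    [/\ forall i, is_polyform (g i) (s i),
        forall i, simplifies (replace_pform I (s i)) (t i)
      & p = \sum_(i < k) (pos_part (t i) + neg_part (t i))].

(* Main.v *)
Require Import Defs.
From HB Require Import structures.
From mathcomp Require Import all_boot all_order all_algebra.
From mathcomp Require Import mpoly.
From mathcomp Require Import boolp reals.

Set Implicit Arguments.
Unset Strict Implicit.
Unset Printing Implicit Defensive.

Import Order.TTheory GRing.Theory Num.Theory.

Local Open Scope ring_scope.

(** The replacement step does not change the value of a polynomial at a point of
    the box, and every power that it introduces is nonnegative there: an even
    power of x_j, a power of x_j^+ or x_j^-, or an odd power of x_j when the
    range of x_j has no negative element. Hence each monomial of the final form
    of g_i is nonnegative at x, and the triangle inequality bounds |g_i(x)| by
    the sum of the |c| * monomial, which is g_i^+(x) + g_i^-(x). *)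

(** Coefficients are left out on purpose: they may have either sign, and only the split into
    [pos_part] and [neg_part] deals with them. *)
Definition monomials_ge0 (R : realType) (n : nat) (v : 'I_n -> R)
    (s : seq (pterm R n)) : bool :=
  all (fun t : pterm R n => 0 <= 'X_[R, t.2].@[v]) s.

Lemma pform_value_cons (R : realType) (n : nat) (t : pterm R n) s :
  pform_value (t :: s) = t.1 *: 'X_[t.2] + pform_value s.
Proof. by rewrite /pform_value big_cons. Qed.

Lemma pform_value1 (R : realType) (n : nat) (t : pterm R n) :
  pform_value [:: t] = t.1 *: 'X_[t.2].
Proof. by rewrite /pform_value big_seq1. Qed.

Lemma pform_value_mul (R : realType) (n : nat) (s t : seq (pterm R n)) :
  pform_value (pform_mul s t) = pform_value s * pform_value t.
Proof.
rewrite /pform_value /pform_mul big_allpairs_dep /= mulr_suml.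
apply: eq_bigr => u _; rewrite mulr_sumr; apply: eq_bigr => w _.
by rewrite mpolyXD -scalerAl -scalerAr scalerA.
Qed.

Lemma monomials_ge0_mul (R : realType) (n : nat) (v : 'I_n -> R) s t :
  monomials_ge0 v s -> monomials_ge0 v t -> monomials_ge0 v (pform_mul s t).
Proof.
move=> /allP s_ge0 /allP t_ge0; apply/allP => w /allpairsP[[u1 u2] /= [us ut ->]].
by rewrite /= mpolyXD mevalM mulr_ge0 //; [apply: s_ge0 | apply: t_ge0].
Qed.

Lemma meval_mpolyXU (R : realType) (n : nat) (v : 'I_n -> R) i a :
  'X_[R, (U_(i) *+ a)%MM].@[v] = v i ^+ a.
Proof. by rewrite -mpolyXn rmorphXn /= mevalXU. Qed.

Section SymbolValues.

Variables (R : realType) (m : nat).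
Implicit Types (x : 'I_m -> R) (I : 'I_m -> interval R).

Lemma sym_val_var x j : sym_val x (sym_var j) = x j.
Proof. by rewrite /sym_val /sym_var (unsplitK (inl _ j)). Qed.

Lemma sym_val_pos x j : sym_val x (sym_pos j) = Num.max (x j) 0.
Proof.
by rewrite /sym_val /sym_pos (unsplitK (inr _ _)) (unsplitK (inl _ j)).
Qed.

Lemma sym_val_neg x j : sym_val x (sym_neg j) = Num.max (- x j) 0.
Proof.
by rewrite /sym_val /sym_neg (unsplitK (inr _ _)) (unsplitK (inr _ j)).
Qed.

(** One of the two maxima is 0, and its power vanishes because an odd [a] is nonzero; if [y <= 0],
    oddness also gives [(- y) ^+ a = - y ^+ a]. *)
Lemma odd_exprB_pos_neg (y : R) a : odd a ->
  Num.max y 0 ^+ a - Num.max (- y) 0 ^+ a = y ^+ a.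
Proof.
case: a => // a a_odd; case/orP: (le_total 0 y) => [y_ge0|y_le0].
  by rewrite max_l // max_r ?oppr_le0 // expr0n subr0.
rewrite max_r // max_l ?oppr_ge0 // expr0n sub0r exprNn -signr_odd a_odd.
by rewrite expr1 mulN1r opprK.
Qed.

(** This justifies keeping an odd power of x_j: a negative element of an unmixed [J] excludes
    positive ones, which would make [J] nonpositive. *)
Lemma not_nonpos_range_ge0 (J : interval R) (y : R) :
  ~ mixed_sign J -> ~ nonpos_range J -> y \in J -> 0 <= y.
Proof.
move=> J_unmixed J_pos yJ; rewrite leNgt; apply/negP => y_lt0; apply: J_pos.
move=> z zJ; rewrite leNgt; apply/negP => z_gt0.
by apply: J_unmixed; split; [exists z | exists y].
Qed.

Lemma replace_factor_value x (J : interval R) j a : x j \in J ->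
  (pform_value (replace_factor J j a)).@[sym_val x] = x j ^+ a.
Proof.
move=> xJ; rewrite /replace_factor.
(* Shared by the two cases that keep the factor: even exponents, and odd ones over a nonnegative
   range. *)
have var_value : (pform_value [:: (1 : R, (U_(sym_var j) *+ a)%MM)]).@[sym_val x]
    = x j ^+ a.
  by rewrite pform_value1 mevalZ mul1r meval_mpolyXU sym_val_var.
case: ifP => // a_odd; case: asboolP => [_|_].
  rewrite pform_value_cons pform_value1 mevalD !mevalZ !meval_mpolyXU.
  by rewrite sym_val_pos sym_val_neg mul1r mulN1r odd_exprB_pos_neg.
case: asboolP => // J_nonpos.
rewrite pform_value1 mevalZ meval_mpolyXU sym_val_neg mulN1r.
(* On a nonpositive range x_j^+ is 0, so only the second power of the odd-power identity
   survives. *)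
rewrite -(odd_exprB_pos_neg (x j) a_odd) (max_r (J_nonpos _ xJ)).
by case: a a_odd {var_value} => // a _; rewrite expr0n sub0r.
Qed.

Lemma replace_factor_ge0 x (J : interval R) j a : x j \in J ->
  monomials_ge0 (sym_val x) (replace_factor J j a).
Proof.
move=> xJ; rewrite /monomials_ge0 /replace_factor.
have max0_ge0 (y : R) : 0 <= Num.max y 0 by rewrite le_max lexx orbT.
case: ifP => a_odd; last first.
  by rewrite /= andbT meval_mpolyXU sym_val_var exprn_even_ge0 // a_odd.
case: asboolP => [_|J_unmixed].
  by rewrite /= !meval_mpolyXU sym_val_pos sym_val_neg !exprn_ge0.
case: asboolP => [_|J_pos]; rewrite /= andbT meval_mpolyXU.
  by rewrite sym_val_neg exprn_ge0.
by rewrite sym_val_var exprn_ge0 //; exact: (not_nonpos_range_ge0 J_unmixed J_pos xJ).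
Qed.

Lemma replace_term_value I x t : (forall j, x j \in I j) ->
  (pform_value (replace_term I t)).@[sym_val x] = (t.1 *: 'X_[t.2]).@[x].
Proof.
move=> xI; rewrite /replace_term pform_value_mul mevalM pform_value1 !mevalZ.
rewrite mpolyX0 meval1 mulr1 mevalX; congr (_ * _).
(* [pform_value] turns the multiplied-out lists into a product in the polynomial ring, which
   evaluation respects factor by factor. *)
have -> : pform_value (\big[@pform_mul R _/[:: (1, 0%MM)]]_(j < m)
      replace_factor (I j) j (t.2 j)) =
    \prod_(j < m) pform_value (replace_factor (I j) j (t.2 j)).
  apply: (big_morph _ (@pform_value_mul R _)).
  by rewrite pform_value1 scale1r mpolyX0.
by rewrite rmorph_prod; apply: eq_bigr => j _; apply: replace_factor_value.
Qed.

Lemma replace_term_ge0 I x t : (forall j, x j \in I j) ->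
  monomials_ge0 (sym_val x) (replace_term I t).
Proof.
move=> xI; have unit_ge0 (c : R) : monomials_ge0 (sym_val x) [:: (c, 0%MM)].
  by rewrite /monomials_ge0 /= mpolyX0 meval1 ler01.
apply: monomials_ge0_mul => //; apply: (big_ind (monomials_ge0 (sym_val x))) => // [s t'|j _].
  exact: monomials_ge0_mul.
exact: (replace_factor_ge0 _ (xI j)).
Qed.

Lemma replace_pform_value I x s : (forall j, x j \in I j) ->
  (pform_value (replace_pform I s)).@[sym_val x] = (pform_value s).@[x].
Proof.
move=> xI; rewrite {1}/pform_value /replace_pform big_flatten big_map /=.
rewrite !raddf_sum; apply: eq_bigr => t _; exact: replace_term_value.
Qed.

Lemma replace_pform_ge0 I x s : (forall j, x j \in I j) ->
  monomials_ge0 (sym_val x) (replace_pform I s).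
Proof.
move=> xI; apply/allP => u /flatten_mapP[t _ u_t].
exact: (allP (replace_term_ge0 t xI)).
Qed.

(** One of x_j^+ and x_j^- is 0 at [x], and it occurs with positive exponent. *)
Lemma meval_posneg x (a : 'X_{1..m + (m + m)}) j :
  (0 < a (sym_pos j))%N -> (0 < a (sym_neg j))%N ->
  'X_[R, a].@[sym_val x] = 0.
Proof.
move=> pos_a neg_a; rewrite mevalX.
case/orP: (le_total (x j) 0) => [x_le0|x_ge0].
  rewrite (bigD1 (sym_pos j)) //= sym_val_pos max_r //.
  by rewrite expr0n eqn0Ngt pos_a mul0r.
rewrite (bigD1 (sym_neg j)) //= sym_val_neg max_r ?oppr_le0 //.
by rewrite expr0n eqn0Ngt neg_a mul0r.
Qed.

(** Equality is claimed only after evaluation: deleting a term that contains both x_j^+ and x_j^-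
    changes the formal polynomial. *)
Lemma simplifies_value x s t : simplifies s t ->
  (pform_value t).@[sym_val x] = (pform_value s).@[sym_val x].
Proof.
elim=> {s t} // [s s' t s_s' _ ->|c d a s t _ _ ->|c d a s t cd0 _ ->
               |c a j s t pos_a neg_a _ ->].
- by rewrite /pform_value (perm_big _ s_s').
- by rewrite !pform_value_cons /= scalerDl addrA.
- by rewrite !pform_value_cons /= addrA -scalerDl cd0 scale0r add0r.
- rewrite pform_value_cons mevalD mevalZ.
  by rewrite (meval_posneg x pos_a neg_a) mulr0 add0r.
Qed.

(** No rule creates a new exponent: each monomial of [t] already occurs in [s]. *)
Lemma simplifies_ge0 x s t : simplifies s t ->
  monomials_ge0 (sym_val x) s -> monomials_ge0 (sym_val x) t.
Proof.
rewrite /monomials_ge0.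
elim=> {s t} // [s s' t s_s' _ IH|c d a s t _ _ IH|c d a s t _ _ IH
               |c a j s t _ _ _ IH].
- by rewrite (perm_all _ s_s').
- by case/and3P=> a_ge0 _ s_ge0; apply: IH; rewrite /= a_ge0.
- by case/and3P=> _ _.
- by case/andP=> _.
Qed.

End SymbolValues.

Lemma meval_pos_neg_part (R : realType) (n : nat) (v : 'I_n -> R) s :
  (pos_part s + neg_part s).@[v] = \sum_(t <- s) `|t.1| * 'X_[t.2].@[v].
Proof.
(* Padding both sums with zeros lets them be compared term by term; a zero coefficient contributes
   to neither. *)
rewrite /pos_part /neg_part big_mkcond /= [X in _ - X]big_mkcond /=.
rewrite -sumrB raddf_sum /=; apply: eq_bigr => t _.
case: (ltgtP t.1 0) => [t_lt0|t_gt0|->].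
- by rewrite sub0r mevalN mevalZ ltr0_norm ?mulNr.
- by rewrite subr0 mevalZ gtr0_norm.
- by rewrite subr0 meval0 normr0 mul0r.
Qed.

Lemma norm_pform_value_le (R : realType) (n : nat) (v : 'I_n -> R) s :
  monomials_ge0 v s ->
  `|(pform_value s).@[v]| <= (pos_part s + neg_part s).@[v].
Proof.
move=> /allP s_ge0; rewrite meval_pos_neg_part /pform_value raddf_sum /=.
apply: le_trans (ler_norm_sum _ _ _) _.
rewrite big_seq [leRHS]big_seq; apply: ler_sum => t /s_ge0 t_ge0.
by rewrite mevalZ normrM (ger0_norm t_ge0).
Qed.

Theorem theorem4p1 (R : realType) (m k : nat) (I : 'I_m -> interval R)
    (g : 'I_k -> {mpoly R[m]}) (eps : R) (p : {mpoly R[m + (m + m)]})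
    (eps_gt0 : 0 < eps) (p_out : PN_output I g p) :
  forall (x : 'I_m -> R) (e : 'I_k -> R),
    (forall j, x j \in I j) ->
    (forall i, `|e i| <= eps) ->
    \sum_(i < k) `|(g i).@[x] * e i| <= p.@[sym_val x] * eps.
Proof.
move=> x e xI e_le; case: p_out => s [t [s_form s_t ->]].
rewrite raddf_sum mulr_suml /=; apply: ler_sum => i _.
rewrite normrM; apply: ler_pM => //.
(* The value of [g i] at [x] is traced through expansion, replacement and simplification to that of
   the final form [t i]. *)
rewrite -(s_form i).2 -(replace_pform_value _ xI) -(simplifies_value x (s_t i)).
apply: norm_pform_value_le; apply: simplifies_ge0 (s_t i) _.
exact: replace_pform_ge0.
Qed.
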